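(* There is an arithmetic term $M(a,b,p,q,n)$ with the following property. Let $a,b,p,q\in\mathbb{N}$ with $b,q\ge 1$, $a\le b$ and $p\le 2q$, and let $x(n)$ be the Tent Map sequence $x(n+1)=\mu\min(x(n),1-x(n))$ with $x(0)=a/b\in[0,1]$ and $\mu=p/q\in[0,2]$. Let $a(n)$, $b(n)$ be the sequences of natural numbers defined by $a(0)=a$, $b(0)=b$, $a(n+1)=p\min(a(n),\,b(n)-a(n))$, $b(n+1)=q\,b(n)$. Then for all $n\in\mathbb{N}$, $$b(n)=bq^n,\qquad a(n)=\left\lfloor \frac{M(a,b,p,q,n)}{\left(bq^n+1\right)^n}\right\rfloor,\qquad x(n)=\frac{a(n)}{b(n)},$$ where the last division is division of rational numbers.
   Context: $\mathbb{N}=\{0,1,2,\dots\}$. An arithmetic term is a finite expression built from variables ranging over $\mathbb{N}$ and natural-number constants by composing addition $x+y$, truncated subtraction $x \dot{-} y=\max(x-y,0)$, multiplication, $\lfloor x/y\rfloor$, $x \bmod y$, and exponentiation $x^y$ (conventions: $x \bmod 0 = x$; for definiteness $\lfloor x/0\rfloor=0$, $0^0=1$). *)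

(* Defs.v *)
From mathcomp Require Import all_boot all_order all_algebra.

Set Implicit Arguments.
Unset Strict Implicit.
Unset Printing Implicit Defensive.

Inductive aterm (k : nat) : Type :=
| AVar of 'I_k
| AConst of nat
| AAdd of aterm k & aterm k
| ASub of aterm k & aterm k
| AMul of aterm k & aterm k
| ADiv of aterm k & aterm k
| AMod of aterm k & aterm k
| AExp of aterm k & aterm k.

(* The ssrnat operations follow the usual conventions at degenerate
   arguments: m - n = 0 if m <= n, m %/ 0 = 0, m %% 0 = m, 0 ^ 0 = 1. *)
Fixpoint aeval (k : nat) (v : k.-tuple nat) (t : aterm k) : nat :=
  match t with
  | AVar i => tnth v i
  | AConst c => c
  | AAdd t1 t2 => aeval v t1 + aeval v t2
  | ASub t1 t2 => aeval v t1 - aeval v t2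
  | AMul t1 t2 => aeval v t1 * aeval v t2
  | ADiv t1 t2 => aeval v t1 %/ aeval v t2
  | AMod t1 t2 => aeval v t1 %% aeval v t2
  | AExp t1 t2 => aeval v t1 ^ aeval v t2
  end.

(* Main.v *)
(* The digits a(0), ..., a(n) in a large base B form a number that is greatest,
   for the lexicographic order with a(0) most significant, among the digit
   sequences t with t(0) <= a, t(i+1) <= p t(i) and t(i+1) + p t(i) <= p b(i):
   taking each digit as large as possible is exactly the tent map.  These
   linear constraints say that the base-B digits of numbers affine in the
   unknown z are small, hence, after concatenation, that the binary expansion
   of some al * z + be is contained in that of a mask m, i.e. (Lucas) that the
   binomial 'C(m, al * z + be) is odd.

   The greatest such z is an arithmetic term: repeating the binary expansions
   in k blocks multiplies the 2-adic valuation of the binomial by k (Kummer),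
   so that in the sum of 2 ^ (L j) * 'C(m R, (al (h - 1 - j) + be) R) over j < h
   the valuation is attained at the greatest solution.  That sum is a
   coefficient of (1 + Y) ^ (m R) times a geometric series, hence is read off
   as a digit in base Y, and its 2-adic valuation is computed by a gcd. *)

Require Import Defs.
From mathcomp Require Import all_boot all_order all_algebra.
From mathcomp Require Import zify ring.

Set Implicit Arguments.
Unset Strict Implicit.
Unset Printing Implicit Defensive.

Import Order.TTheory GRing.Theory Num.Theory.

(** * Binomial coefficients modulo powers of 2 *)

(** Pascal's rule applied twice: modulo 2, ['C(N + 2, K + 2)] is ['C(N, K + 2) + 'C(N, K)], since
    the middle term occurs twice. *)
Lemma odd_bin_double (b c : bool) n k :
  odd 'C(b + n.*2, c + k.*2) = odd 'C(b, c) && odd 'C(n, k).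
Proof.
elim: n k => [|n IHn] [|k].
- by rewrite !addn0 andbT.
- by rewrite bin0n andbF bin_small //; case: b; case: c; rewrite doubleS; lia.
- by rewrite !addn0 bin0 andbT; case: (c); rewrite ?bin0 // !bin1 oddD odd_double; case: (b).
rewrite !doubleS !addnS !binS !oddD.
have -> : odd 'C(b + n.*2, (c + k.*2).+2) = odd 'C(b, c) && odd 'C(n, k.+1).
  by rewrite -IHn doubleS !addnS.
rewrite IHn; move: (odd 'C(b + n.*2, _.+1)) (odd 'C(b, c)) (odd 'C(n, k.+1)) (odd 'C(n, k)).
by do 4!case.
Qed.

(* Lucas' theorem modulo 2 *)
Lemma odd_bin_digits d m1 x1 m2 x2 : m1 < 2 ^ d -> x1 < 2 ^ d ->
  odd 'C(m1 + 2 ^ d * m2, x1 + 2 ^ d * x2) = odd 'C(m1, x1) && odd 'C(m2, x2).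
Proof.
elim: d m1 x1 => [|d IHd] m1 x1; first by case: m1 x1 => [|?] [|?] //; rewrite !mul1n.
have half_lt u : u < 2 ^ d.+1 -> u./2 < 2 ^ d by rewrite expnS; lia.
move=> /half_lt lt_m1 /half_lt lt_x1.
rewrite -(odd_double_half m1) -(odd_double_half x1) expnS.
by rewrite -!mulnA !mul2n -!addnA -!doubleD !odd_bin_double IHd ?andbA.
Qed.

(** The mask [2 ^ w - 1] has all its [w] bits set, hence contains every [w]-bit expansion. *)
Lemma odd_bin_ones w x : odd 'C(2 ^ w - 1, x) = (x < 2 ^ w).
Proof.
elim: w x => [|w IHw] x; first by case: x.
have -> : 2 ^ w.+1 - 1 = true + (2 ^ w - 1).*2.
  by rewrite expnS; have := expn_gt0 2 w; lia.
rewrite -{1}(odd_double_half x) odd_bin_double IHw /=.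
have -> : odd 'C(1, odd x) by case: (odd x).
by rewrite expnS -{2}(odd_double_half x) /=; case: (odd x); lia.
Qed.

(** One step of Legendre's formula: the even factors multiply to [2 ^ n * n!], the others are
    odd. *)
Lemma logn2_fact_double (b : bool) n :
  logn 2 (b + n.*2)`! = n + logn 2 n`!.
Proof.
suff E : logn 2 (n.*2)`! = n + logn 2 n`!.
  case: b => //=; rewrite add1n factS lognM ?fact_gt0 // E.
  by rewrite lognE /= dvdn2 /= odd_double.
elim: n => // n IHn.
rewrite doubleS !factS !lognM ?muln_gt0 ?fact_gt0 // IHn.
rewrite -doubleS -mul2n lognM // [logn 2 n.*2.+1]lognE dvdn2 /= odd_double /=.
by rewrite logn_prime //=; lia.
Qed.

(** [d] steps of Legendre's formula; [b] stands on the left to avoid a truncated subtraction. *)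
Lemma logn2_fact_digits d a b : a < 2 ^ d ->
  logn 2 (a + 2 ^ d * b)`! + b = logn 2 a`! + 2 ^ d * b + logn 2 b`!.
Proof.
elim: d a => [|d IHd] a; first by case: a => // _; rewrite !add0n !mul1n /= addnC.
move=> lt_a; have /IHd {}IHd : a./2 < 2 ^ d.
  by move: lt_a; rewrite expnS -{1}(odd_double_half a); lia.
rewrite -(odd_double_half a) expnS -mulnA mul2n -addnA -doubleD.
rewrite !logn2_fact_double; lia.
Qed.

Definition repunit B k := \sum_(i < k) B ^ i.

Lemma repunitS B k : repunit B k.+1 = 1 + B * repunit B k.
Proof.
rewrite /repunit big_ord_recl big_distrr /=; congr (_ + _).
by apply: eq_bigr => i _; rewrite /bump add1n expnS.
Qed.

Lemma repunit_expn B k : (B - 1) * repunit B k = B ^ k - 1.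
Proof. by rewrite !subn1 predn_exp. Qed.

Lemma repunit_divn B k : 1 < B -> repunit B k = (B ^ k - 1) %/ (B - 1).
Proof. by move=> lt1B; rewrite -repunit_expn mulKn // subn_gt0. Qed.

(* Repeating the binary expansions of [m] and [x] in [k] blocks repeats the
   borrows of [m - x], whose number is the 2-adic valuation of ['C(m, x)]. *)
Lemma logn2_bin_repunit d m x k : x <= m -> m < 2 ^ d ->
  logn 2 'C(m * repunit (2 ^ d) k, x * repunit (2 ^ d) k) = k * logn 2 'C(m, x).
Proof.
move=> le_xm lt_m.
(* Valuation of ['C(u, v) * v! * (u - v)! = u!], kept additive. *)
have lfact u v : v <= u -> logn 2 'C(u, v) + (logn 2 v`! + logn 2 (u - v)`!) = logn 2 u`!.
  by move=> le_vu; rewrite -(bin_fact le_vu) !lognM ?muln_gt0 ?fact_gt0 ?bin_gt0.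
elim: k => [|k IHk]; first by rewrite /repunit big_ord0 !muln0.
rewrite mulSn -IHk repunitS; set r := repunit _ _.
have D y : y * (1 + 2 ^ d * r) = y + 2 ^ d * (y * r) by ring.
have le_r : x * r <= m * r by rewrite leq_mul2r le_xm orbT.
have := lfact _ _ le_r; have := lfact _ _ le_xm.
have := lfact (m * (1 + 2 ^ d * r)) (x * (1 + 2 ^ d * r)).
rewrite leq_mul2r le_xm orbT -!mulnBl !D => /(_ isT).
have := logn2_fact_digits (m * r) lt_m.
have := logn2_fact_digits (x * r) (leq_ltn_trans le_xm lt_m).
have := @logn2_fact_digits d (m - x) ((m - x) * r) (leq_ltn_trans (leq_subr _ _) lt_m).
have E : (m - x) * r + x * r = m * r by rewrite -mulnDl subnK.
have E' : 2 ^ d * ((m - x) * r) + 2 ^ d * (x * r) = 2 ^ d * (m * r).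
  by rewrite -mulnDr E.
lia.
Qed.

(** * Closed forms *)

(** No carry occurs, as the coefficients total less than [Y]: exponents below [T] contribute less
    than [Y ^ T], those above [T] a multiple of [Y ^ T.+1]. *)
Lemma sum_expn_coef (I : finType) (c e : I -> nat) Y T :
  \sum_i c i < Y ->
  (\sum_i c i * Y ^ e i) %/ Y ^ T %% Y = \sum_(i | e i == T) c i.
Proof.
move=> lt_Y; have Y0 : 0 < Y by apply: leq_ltn_trans lt_Y.
rewrite (bigID (fun i => e i < T)) /= [X in _ + X](bigID (fun i => e i == T)) /=.
set lo := (X in X + _); set mid := (X in _ + (X + _)); set hi := (X in _ + (_ + X)).
have lo_lt : lo < Y ^ T.
  case: (posnP T) => [T0|T0].
    by rewrite /lo big_pred0 ?expn_gt0 ?Y0 // => i; rewrite T0.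
  apply: (@leq_ltn_trans (\sum_i c i * Y ^ T.-1)).
    rewrite /lo big_mkcond /=; apply: leq_sum => i _; case: ifP => // lt_eT.
    by rewrite leq_mul2l leq_pexp2l ?orbT //; lia.
  by rewrite -big_distrl /= -{2}(prednK T0) expnS ltn_mul2r expn_gt0 Y0 lt_Y.
have midE : mid = Y ^ T * \sum_(i | e i == T) c i.
  rewrite big_distrr /= /mid; apply: eq_big => [i|i /andP[_ /eqP->]]; last exact: mulnC.
  by case: ltngtP.
have [h hiE] : exists h, hi = Y ^ T * (Y * h).
  exists (\sum_(i | ~~ (e i < T) && (e i != T)) c i * Y ^ (e i - T.+1)).
  rewrite 2!big_distrr /= /hi; apply: eq_bigr => i; rewrite -leqNgt => /andP[le_T ne_T].
  have {1}-> : e i = T + 1 + (e i - T.+1) by lia.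
  by rewrite !expnD expn1; ring.
rewrite midE hiE -mulnDr addnC mulnC divnMDl ?expn_gt0 ?Y0 //.
rewrite (divn_small lo_lt) addn0 addnC mulnC modnMDl modn_small //.
by apply: leq_ltn_trans lt_Y; rewrite [leqRHS](bigID (fun i => e i == T)) leq_addr.
Qed.

Lemma sum_dvdn g d : 0 < d -> \sum_(i < d * g) (d %| i) = g.
Proof.
move=> d0; elim: g => [|g IHg]; first by rewrite muln0 big_ord0.
rewrite mulnS addnC -(big_mkord predT (fun i => nat_of_bool (d %| i))).
rewrite (big_cat_nat (n := d * g)) ?leq_addr //= big_mkord IHg.
rewrite -{1}[d * g]add0n big_addn addKn big_ltn // add0n dvdn_mulr //.
rewrite big_nat big1 ?addn0 ?addn1 // => i /andP[i0 lt_i].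
by rewrite dvdn_addl ?dvdn_mulr // gtnNdvd.
Qed.

(* Modulo [N.+1 ^ N - 1] the quotient is the sum of the [N.+1 ^ (W * i %% N)] for
   [i < N], whose last digit is the number of [i < N] with [N %| W * i]. *)
Lemma gcdn_expn W N : 0 < W -> 1 < N ->
  gcdn W N =
  (((N.+1 ^ (W * N) - 1) %/ (N.+1 ^ W - 1)) %% (N.+1 ^ N - 1)) %% N.+1.
Proof.
move=> W0 N1; have N0 : 0 < N by apply: ltnW.
have rW : 1 < N.+1 ^ W by rewrite -(exp1n W) ltn_exp2r.
rewrite expnM -repunit_divn // /repunit.
have rN : 0 < N.+1 ^ N - 1 by rewrite subn_gt0 -(exp1n N) ltn_exp2r.
have -> : (\sum_(i < N) (N.+1 ^ W) ^ i) %% (N.+1 ^ N - 1) =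
    \sum_(i < N) N.+1 ^ ((W * i) %% N).
  (* [N] summands, each at most [N.+1 ^ N.-1], stay below the modulus. *)
  rewrite -[RHS](@modn_small _ (N.+1 ^ N - 1)); last first.
    apply: (@leq_ltn_trans (\sum_(i < N) N.+1 ^ N.-1)).
      by apply: leq_sum => i _; rewrite leq_pexp2l // -ltnS prednK // ltn_mod.
    have -> : N.+1 ^ N = N.+1 * N.+1 ^ N.-1 by rewrite -expnS prednK.
    rewrite sum_nat_const card_ord.
    have : 1 < N.+1 ^ N.-1 by rewrite -(exp1n N.-1) ltn_exp2r //; lia.
    lia.
  rewrite -[LHS]modn_summ -[RHS]modn_summ; congr (_ %% _); apply: eq_bigr => i _.
  rewrite -expnM {1}(divn_eq (W * i) N) expnD mulnC [_ %/ N * N]mulnC expnM.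
  have E1 : N.+1 ^ N = 1 %[mod N.+1 ^ N - 1].
    by rewrite -{1}(subnK (_ : 0 < N.+1 ^ N)) ?expn_gt0 // modnDl.
  by rewrite -modnMmr -modnXm E1 modnXm modnMmr exp1n muln1.
rewrite -modn_summ.
have -> : \sum_(i < N) (N.+1 ^ ((W * i) %% N)) %% N.+1 = \sum_(i < N) (N %| W * i).
  apply: eq_bigr => i _; rewrite /dvdn.
  case: ((W * i) %% N) => [|e]; first by rewrite expn0 modn_small.
  by rewrite expnS modnMr.
(* With [N = d * gcdn W N], [N] divides [W * i] iff [d] divides [i], and [gcdn W N] multiples of [d]
   lie below [N]. *)
have [d Nd] := dvdnP (dvdn_gcdr W N).
have g0 : 0 < gcdn W N by rewrite gcdn_gt0 W0.
have d0 : 0 < d by case: d Nd N0 => // ->.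
have E i : (N %| W * i) = (d %| i).
  have [u Wu] := dvdnP (dvdn_gcdl W N).
  have co : coprime d u.
    by rewrite /coprime gcdnC -(eqn_pmul2r g0) mul1n muln_gcdl -Wu -Nd.
  move: (gcdn W N) g0 Nd Wu => g g0 -> ->.
  by rewrite mulnAC dvdn_pmul2r // Gauss_dvdr.
rewrite (eq_bigr (fun i : 'I_N => nat_of_bool (d %| i))); last by move=> i _; rewrite E.
rewrite -(big_mkord predT (fun i => nat_of_bool (d %| i))) [in index_iota _ N]Nd.
by rewrite big_mkord sum_dvdn // modn_small // ltnS dvdn_leq // dvdn_gcdr.
Qed.

Lemma expn_add1_mod u j : (1 + u) ^ j = 1 + j * u %[mod u ^ 2].
Proof.
elim: j => // j IHj; rewrite expnS -modnMmr IHj modnMmr.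
have -> : (1 + u) * (1 + j * u) = j * u ^ 2 + (1 + j.+1 * u) by ring.
by rewrite modnMDl.
Qed.

(** A discrete logarithm: with [u = 2 ^ L - 1] the power is [(1 + u) ^ j], congruent to [1 + j * u]
    modulo [u ^ 2]; as [j < u] and [1 < u], this is the remainder itself. *)
Lemma log_expn L j : 1 < L -> j < 2 ^ L - 1 ->
  2 ^ (L * j) %% (2 ^ L - 1) ^ 2 %/ (2 ^ L - 1) = j.
Proof.
move=> L1; rewrite expnM; have : 2 ^ 2 <= 2 ^ L by rewrite leq_pexp2l.
have [u] : {u | 2 ^ L = 1 + u} by exists (2 ^ L - 1); rewrite subnKC ?expn_gt0.
move=> ->; rewrite addKn => u2 ltju.
rewrite expn_add1_mod modn_small; first by rewrite addnC divnMDl ?divn_small ?addn0; lia.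
have : j.+1 * u <= u ^ 2 by rewrite expnS expn1 leq_mul2r ltju orbT.
rewrite mulSn; lia.
Qed.

Lemma gcdn_expn2 a b h : a <= b -> gcdn (2 ^ a * h.*2.+1) (2 ^ b) = 2 ^ a.
Proof.
move=> leab; rewrite -(subnKC leab) expnD -muln_gcdr.
suff /eqP-> : coprime h.*2.+1 (2 ^ (b - a)) by rewrite muln1.
by rewrite coprimeXr // coprimen2 /= odd_double.
Qed.

(** Expanding in [y = 2 ^ Y], term [j] of the geometric series and term [X] of the binomial meet at
    exponent [X + s * j]; the digit at [T] selects [X = T - s * j]. *)
Lemma bin_convolution_coef E H s L T Y : E + L * H < Y -> 0 < L ->
  ((1 + 2 ^ Y) ^ E * repunit ((2 ^ Y) ^ s * 2 ^ L) H) %/ (2 ^ Y) ^ T %% 2 ^ Y =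
  \sum_(j < H) (if s * j <= T then 2 ^ (L * j) * 'C(E, T - s * j) else 0).
Proof.
move=> ltY L0; set y := 2 ^ Y.
pose c (i : 'I_H * 'I_E.+1) := 2 ^ (L * i.1) * 'C(E, i.2).
pose e (i : 'I_H * 'I_E.+1) := i.2 + s * i.1.
have -> : (1 + y) ^ E * repunit (y ^ s * 2 ^ L) H = \sum_i c i * y ^ e i.
  rewrite mulnC /repunit big_distrl /= -(pair_bigA _ (fun j X => c (j, X) * y ^ e (j, X))) /=.
  apply: eq_bigr => j _; rewrite expnDn big_distrr /=; apply: eq_bigr => X _.
  by rewrite /c /e /= exp1n mul1n expnMn expnD (expnM y s) (expnM 2 L); ring.
(* The coefficients total at most [2 ^ E * 2 ^ (L * H)], below the base [2 ^ Y]. *)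
rewrite sum_expn_coef; last first.
  rewrite -(pair_bigA _ (fun j X => c (j, X))) /= /c /=.
  under eq_bigr => j _ do rewrite -big_distrr /= .
  have -> : \sum_(X < E.+1) 'C(E, X) = 2 ^ E.
    by rewrite -[2]/(1 + 1) expnDn; apply: eq_bigr => X _; rewrite !exp1n !muln1.
  rewrite -big_distrl /= mulnC.
  apply: (@leq_ltn_trans (2 ^ E * 2 ^ (L * H))); last by rewrite -expnD ltn_exp2l.
  rewrite leq_mul2l; apply/orP; right; apply/ltnW.
  rewrite expnM -(ltn_predK (_ : 0 < (2 ^ L) ^ H)) ?expn_gt0 //.
  rewrite predn_exp; under eq_bigr => j _ do rewrite expnM.
  by rewrite ltnS leq_pmull // -subn1 subn_gt0 -{1}(expn0 2) ltn_exp2l.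
rewrite -(pair_big_dep xpredT (fun j X => e (j, X) == T) (fun j X => c (j, X))) /=.
apply: eq_bigr => j _; rewrite /e /c /=; case: leqP => [le_T|lt_T]; last first.
  by rewrite big_pred0 // => X; lia.
case: (leqP (T - s * j) E) => [le_E|lt_E]; last first.
  rewrite bin_small // muln0 big_pred0 // => X; have := ltn_ord X; lia.
rewrite (big_pred1 (Ordinal (le_E : T - s * j < E.+1))) // => X /=.
by rewrite -val_eqE /=; lia.
Qed.

(** Modulo [2 ^ (L * j0).+1] only term [j0] survives: earlier terms vanish through [w j], later ones
    through their own power of 2. *)
Lemma sum_expn2_odd H L (w : nat -> nat) j0 : 0 < L -> j0 < H -> odd (w j0) ->
  (forall j, j < j0 -> 2 ^ (L * H) %| w j) ->
  exists h, \sum_(j < H) 2 ^ (L * j) * w j = 2 ^ (L * j0) * h.*2.+1.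
Proof.
move=> L0 lt_j0 w_odd w_div.
have D j : j < H -> j != j0 -> 2 ^ (L * j0).+1 %| 2 ^ (L * j) * w j.
  move=> lt_j; case: ltngtP => // [lt_jj0|gt_jj0] _.
    apply/dvdn_mull/(dvdn_trans _ (w_div _ lt_jj0)).
    by rewrite dvdn_exp2l // ltn_mul2l L0.
  by apply/dvdn_mulr; rewrite dvdn_exp2l // ltn_mul2l L0.
have : 2 ^ (L * j0).+1 %| \sum_(j < H | j != Ordinal lt_j0) 2 ^ (L * j) * w j.
  by apply: dvdn_sum => j nej; apply: D.
case/dvdnP => q Eq; exists (q + (w j0)./2).
rewrite (bigD1 (Ordinal lt_j0)) //= Eq -{1}(odd_double_half (w j0)) w_odd expnS.
rewrite -!mul2n -[nat_of_bool true]/1 -[(2 * _).+1]addn1; ring.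
Qed.

(** * Arithmetic terms *)

Declare Scope aterm_scope.
Delimit Scope aterm_scope with A.
Bind Scope aterm_scope with aterm.
Notation "n %:A" := (AConst _ n) : aterm_scope.
Notation "s + t" := (AAdd s t) : aterm_scope.
Notation "s - t" := (ASub s t) : aterm_scope.
Notation "s * t" := (AMul s t) : aterm_scope.
Notation "s %/ t" := (ADiv s t) : aterm_scope.
Notation "s %% t" := (AMod s t) : aterm_scope.
Notation "s ^ t" := (AExp s t) : aterm_scope.

Section Terms.
Variables (k : nat) (v : k.-tuple nat).
Implicit Types s t : aterm k.
Local Notation "[[ t ]]" := (aeval v t%A) (at level 0).

Definition arepunit s t := ((s ^ t - 1%:A) %/ (s - 1%:A))%A.

Lemma aeval_repunit s t : 1 < [[s]] -> [[arepunit s t]] = repunit [[s]] [[t]].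
Proof. by move=> lt1s; rewrite repunit_divn. Qed.

Definition agcd s t :=
  let r := (t + 1%:A)%A in
  (((r ^ (s * t) - 1%:A) %/ (r ^ s - 1%:A)) %% (r ^ t - 1%:A) %% r)%A.

Lemma aeval_gcd s t : 0 < [[s]] -> 1 < [[t]] -> [[agcd s t]] = gcdn [[s]] [[t]].
Proof. by move=> s0 t1; rewrite gcdn_expn //= addn1. Qed.

(* [L] is the spacing of the candidates, [R] repeats expansions in [L * h] blocks,
   and [Y] exceeds the sum of the coefficients of the generating function. *)
Definition amasked_sum al be m h : aterm k :=
  let L := (h + 1%:A)%A in
  let R := arepunit (2%:A ^ (m + 1%:A))%A (L * h)%A in
  let E := (m * R)%A in
  let Y := (2%:A ^ (E + L * h + 1%:A))%A in
  ((1%:A + Y) ^ E * arepunit (Y ^ (al * R) * 2%:A ^ L)%A h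
     %/ Y ^ ((al * (h - 1%:A) + be) * R) %% Y)%A.

(* If the sum has 2-adic valuation [L * j], the gcd is [(1 + u) ^ j], which is
   [1 + j * u] modulo [u ^ 2]. *)
Definition amax_masked al be m h : aterm k :=
  let L := (h + 1%:A)%A in
  let u := (2%:A ^ L - 1%:A)%A in
  (h - 1%:A - agcd (amasked_sum al be m h) (2%:A ^ (L * h)) %% u ^ 2%:A %/ u)%A.

(** * The greatest masked candidate as a term *)

Section MaxMasked.
Variables al be m h : aterm k.
Let R := repunit (2 ^ ([[m]] + 1)) (([[h]] + 1) * [[h]]).
Let w j := 'C([[m]] * R, ([[al]] * ([[h]] - 1 - j) + [[be]]) * R).

Lemma aeval_masked_sum : 0 < [[h]] ->
  [[amasked_sum al be m h]] = \sum_(j < [[h]]) 2 ^ (([[h]] + 1) * j) * w j.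
Proof.
move=> h0; set L := [[h]] + 1.
set E := [[m]] * R; set Y := E + L * [[h]] + 1.
set T := ([[al]] * ([[h]] - 1) + [[be]]) * R.
have Rv : [[arepunit (2%:A ^ (m + 1%:A))%A ((h + 1%:A) * h)%A]] = R.
  by rewrite aeval_repunit //= -(expn0 2) ltn_exp2l // addn1.
have ltY : E + L * [[h]] < Y by rewrite /Y addn1.
have L0 : 0 < L by rewrite /L addn1.
have S := bin_convolution_coef ([[al]] * R) T ltY L0.
transitivity (\sum_(j < [[h]])
    (if [[al]] * R * j <= T then 2 ^ (L * j) * 'C(E, T - [[al]] * R * j) else 0)).
  rewrite -S /amasked_sum; cbv zeta.
  move: (arepunit (2%:A ^ (m + 1%:A)) _)%A Rv => rep Rv.
  have Yv : [[2%:A ^ (m * rep + (h + 1%:A) * h + 1%:A)]] = 2 ^ Y by rewrite /= Rv.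
  move: (2%:A ^ _)%A Yv => y Yv.
  have repv : [[arepunit (y ^ (al * rep) * 2%:A ^ (h + 1%:A))%A h]] =
      repunit ((2 ^ Y) ^ ([[al]] * R) * 2 ^ L) [[h]].
    rewrite aeval_repunit /= Yv Rv //.
    apply: leq_trans (leq_pmull _ _); last by rewrite !expn_gt0.
    by rewrite -{1}(expn0 2) ltn_exp2l ?addn1.
  move: (arepunit (y ^ _ * _)%A h) repv => rep' repv.
  by rewrite /= repv Yv Rv.
apply: eq_bigr => j _; have lt_j := ltn_ord j.
have -> : T = ([[al]] * ([[h]] - 1 - j) + [[be]]) * R + [[al]] * R * j.
  rewrite /T -{1}(subnK (_ : j <= [[h]] - 1)); last by lia.
  by ring.
by rewrite leq_addl addnK.
Qed.

(** Index [j] stands for the candidate [h - 1 - j], so candidates above [z0] come first in the sum.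
    Their binomials are zero or even, and repetition in [L * h] blocks raises the valuation to at
    least [L * h]; the one at [z0] stays odd. The sum thus has valuation [L * (h - 1 - z0)]. *)
Lemma aeval_max_masked z0 : z0 < [[h]] ->
  odd 'C([[m]], [[al]] * z0 + [[be]]) ->
  (forall z, z0 < z < [[h]] -> ~~ odd 'C([[m]], [[al]] * z + [[be]])) ->
  [[amax_masked al be m h]] = z0.
Proof.
move=> lt_z0 odd_z0 even_z; have h0 : 0 < [[h]] by apply: leq_ltn_trans lt_z0.
have le_masked x : odd 'C([[m]], x) -> x <= [[m]].
  by case: leqP => // lt_m; rewrite bin_small.
have lt_m : [[m]] < 2 ^ ([[m]] + 1) by rewrite addn1 ltnW // ltn_expl.
have evenE n : 0 < n -> ~~ odd n = (0 < logn 2 n).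
  by move=> n0; rewrite -dvdn2 -[2 in LHS]expn1 pfactor_dvdn.
have L0 : 0 < [[h]] + 1 by rewrite addn1.
have lt_j0 : [[h]] - 1 - z0 < [[h]] by lia.
have w_odd : odd (w ([[h]] - 1 - z0)).
  rewrite /w (_ : [[h]] - 1 - _ = z0); last by lia.
  have le_xm := le_masked _ odd_z0.
  apply: contraLR odd_z0; rewrite !evenE ?bin_gt0 ?leq_mul2r ?le_xm ?orbT //.
  by rewrite logn2_bin_repunit // muln_gt0 => /andP[].
have w_div j : j < [[h]] - 1 - z0 -> 2 ^ (([[h]] + 1) * [[h]]) %| w j.
  move=> lt_j; set z := [[h]] - 1 - j.
  have /even_z : z0 < z < [[h]] by rewrite /z; lia.
  rewrite /w -/z; set x := _ + _; case: (leqP x [[m]]) => [le_xm|lt_mx].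
    rewrite evenE ?bin_gt0 // => log_gt0.
    rewrite pfactor_dvdn ?bin_gt0 ?leq_mul2r ?le_xm ?orbT //.
    by rewrite logn2_bin_repunit // leq_pmulr.
  move=> _; rewrite bin_small ?dvdn0 // ltn_mul2r lt_mx andbT /R.
  by rewrite -(@ltn_predK 0 (_ * _)) ?muln_gt0 ?L0 // repunitS.
have [q Q] := sum_expn2_odd L0 lt_j0 w_odd w_div.
have S := etrans (aeval_masked_sum h0) Q.
rewrite /amax_masked; cbv zeta.
move: (amasked_sum _ _ _ _) S => t S.
rewrite -[LHS]/([[h]] - 1 - [[agcd t (2%:A ^ ((h + 1%:A) * h))]]
  %% (2 ^ ([[h]] + 1) - 1) ^ 2 %/ (2 ^ ([[h]] + 1) - 1)).
have N1 : 1 < 2 ^ (([[h]] + 1) * [[h]]) by rewrite -{1}(expn0 2) ltn_exp2l // muln_gt0 L0.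
rewrite aeval_gcd ?S //; last by rewrite muln_gt0 expn_gt0.
rewrite gcdn_expn2; last by rewrite leq_mul2l ltnW ?orbT.
rewrite log_expn; [lia| by rewrite addn1 |].
have := ltn_expl ([[h]] + 1) (isT : 1 < 2); lia.
Qed.
End MaxMasked.
End Terms.

(** * The tent map as a greatest masked number *)

(** The values of [f] may exceed [B], so that sums and multiples are taken digitwise. *)
Definition digits B (f : nat -> nat) l := \sum_(i < l) f i * B ^ i.

Lemma digitsSr B f l : digits B f l.+1 = digits B f l + f l * B ^ l.
Proof. exact: big_ord_recr. Qed.

Lemma digitsSl B f l : digits B f l.+1 = f 0 + B * digits B (f \o succn) l.
Proof.
rewrite /digits big_ord_recl muln1 big_distrr /=; congr (_ + _).
by apply: eq_bigr => i _; rewrite /bump add1n expnS mulnCA.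
Qed.

Lemma digitsD B f g l : digits B f l + digits B g l = digits B (fun i => f i + g i) l.
Proof. by rewrite -big_split; apply: eq_bigr => i _; rewrite mulnDl. Qed.

Lemma digitsM B c f l : c * digits B f l = digits B (fun i => c * f i) l.
Proof. by rewrite /digits big_distrr /=; apply: eq_bigr => i _; rewrite mulnA. Qed.

Lemma eq_digits B f g l : (forall i, i < l -> f i = g i) -> digits B f l = digits B g l.
Proof. by move=> fg; apply: eq_bigr => i _; rewrite fg. Qed.

Lemma digits_const B c l : digits B (fun=> c) l = c * repunit B l.
Proof. by rewrite big_distrr. Qed.

Definition shift_digits (f : nat -> nat) i := if i is i'.+1 then f i' else 0.

Lemma digits_shift B f l : f l = 0 ->
  B * digits B f l.+1 = digits B (shift_digits f) l.+1.
Proof. by move=> fl0; rewrite digitsSr fl0 addn0 [RHS]digitsSl. Qed.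

Lemma digits_lt B f l : (forall i, i < l -> f i < B) -> digits B f l < B ^ l.
Proof.
elim: l => [|l IHl] lt_f; first by rewrite /digits big_ord0.
have lt_l : digits B f l < B ^ l by apply: IHl => i lt_i; rewrite lt_f ?leqW.
rewrite digitsSr expnS; apply: (@leq_trans ((f l).+1 * B ^ l)).
  by rewrite mulSn ltn_add2r.
by rewrite leq_mul2r lt_f ?orbT.
Qed.

Lemma digits_inj B f g l : (forall i, i < l -> f i < B) -> (forall i, i < l -> g i < B) ->
  digits B f l = digits B g l -> forall i, i < l -> f i = g i.
Proof.
elim: l f g => // l IHl f g lt_f lt_g; rewrite !digitsSl => E.
have B0 : 0 < B by apply: leq_ltn_trans (lt_f 0 _).
have [E0 E1] : f 0 = g 0 /\ digits B (f \o succn) l = digits B (g \o succn) l.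
  have := congr1 (modn^~ B) E; have := congr1 (divn^~ B) E.
  by rewrite /= ![_ + B * _]addnC ![B * _]mulnC !modnMDl !divnMDl //
    !divn_small ?modn_small ?lt_f ?lt_g // !addn0.
case=> // i lt_i; apply: (IHl (f \o succn) (g \o succn)) => // j lt_j.
  exact: lt_f.
exact: lt_g.
Qed.

(** Going down from the top digit, a strict inequality there outweighs all lower digits of [f],
    which total less than [B ^ l]. *)
Lemma leq_digits_lex B f g l : (forall i, i < l -> f i < B) ->
  (forall k, k < l -> (forall i, k < i < l -> f i = g i) -> f k <= g k) ->
  digits B f l <= digits B g l.
Proof.
elim: l => [|l IHl] lt_f lex; first by rewrite /digits !big_ord0.
rewrite !digitsSr; have := lex l (ltnSn l); case: ltngtP => [lt_fg _|lt_gf le_fg|eq_fg _].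
- apply: ltnW; apply: (@leq_trans ((f l).+1 * B ^ l)).
    by rewrite mulSn ltn_add2r digits_lt // => i lt_i; rewrite lt_f ?leqW.
  by apply: leq_trans (leq_addl _ _); rewrite leq_mul2r lt_fg orbT.
- by have := le_fg (fun i H => ltac:(lia)).
rewrite eq_fg leq_add2r IHl // => [i lt_i|k lt_k eq_k]; first by rewrite lt_f ?leqW.
apply: lex => [|i /andP[lt_ki]]; first exact: leqW.
by rewrite ltnS leq_eqVlt => /predU1P[->|lt_il] //; apply: eq_k; rewrite lt_ki.
Qed.

(** The mask has the low half of each [2 * w]-bit block set, so Lucas' theorem checks block by block
    that digits fit in [w] bits. *)
Lemma masked_digitsP w l x :
  reflect (exists2 f, x = digits (2 ^ (2 * w)) f l & forall i, f i < 2 ^ w)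
          (odd 'C((2 ^ w - 1) * repunit (2 ^ (2 * w)) l, x)).
Proof.
have w0 : 0 < 2 ^ w by rewrite expn_gt0.
have le_w : 2 ^ w <= 2 ^ (2 * w) by rewrite leq_exp2l // leq_pmull.
elim: l x => [|l IHl] x.
  rewrite /repunit big_ord0 muln0; apply: (iffP idP) => [|[f -> _]]; last first.
    by rewrite /digits big_ord0.
  by case: x => // _; exists (fun=> 0); rewrite // /digits big_ord0.
have E y x' : y < 2 ^ (2 * w) -> odd 'C((2 ^ w - 1) * repunit (2 ^ (2 * w)) l.+1,
    y + 2 ^ (2 * w) * x') = (y < 2 ^ w) && odd 'C((2 ^ w - 1) * repunit (2 ^ (2 * w)) l, x').
  move=> lt_y; rewrite -odd_bin_ones -(@odd_bin_digits (2 * w)) //; last by apply: leq_trans le_w; lia.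
  by rewrite repunitS mulnDr muln1 mulnCA.
apply: (iffP idP) => [|[f -> lt_f]].
  have Dx : x = x %% 2 ^ (2 * w) + 2 ^ (2 * w) * (x %/ 2 ^ (2 * w)).
    by rewrite addnC mulnC -divn_eq.
  rewrite {1}Dx E ?ltn_pmod ?expn_gt0 //.
  case/andP=> lt_x /IHl[f Ex lt_f]; exists (fun i => if i is i'.+1 then f i' else x %% 2 ^ (2 * w)).
    by rewrite {1}Dx {1}Ex digitsSl.
  by case.
rewrite digitsSl E ?lt_f ?(leq_trans (lt_f 0)) //=.
by apply/IHl; exists (f \o succn) => // i; apply: lt_f.
Qed.

(* Digits below [2 ^ w] in base [2 ^ (2 * w)] leave room for the multiplications
   by [p], so that no carry occurs.  Position [i] holds the term of index [n - i].
   The slacks are complemented to [K]: the digits of [tent_slack1 z] are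
   [K - (p t_i - t_(i+1))] and those of [tent_slack2 z] are
   [K - (p c_i - p t_i - t_(i+1))], with [K - (a - t_0)] on top of both, so that
   they increase with [z] and being at most [K] amounts to the constraints. *)
Section TentMask.
Variables (w n a p : nat) (c t : nat -> nat).
Let B := 2 ^ (2 * w).
Let K := 2 ^ w - 1.
Let M := K * repunit B n.+2.
Let rev (u : nat -> nat) i := if i <= n then u (n - i) else 0.
Let top (i : nat) := if i == n.+1 then a else 0.

Definition tent_slack1 z := M - a * B ^ n.+1 + (B - p) * z.
Definition tent_slack2 z :=
  M - (p * digits B (rev c) n.+2 + a * B ^ n.+1) + (B + p) * z.
Definition tent_code := digits B (rev t) n.+2.

Hypothesis lt_p : p + 3 <= 2 ^ w.
Hypothesis le_aK : a <= K.
Hypothesis le_cK : forall i, i <= n -> p * c i <= K.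
Hypothesis t0 : t 0 = a.
Hypothesis tS : forall i, t i.+1 = p * minn (t i) (c i - t i).
Hypothesis le_tc : forall i, t i <= c i.

(** [(p + 3) * K] bounds every digit in the equations below, so equal numbers have equal digits. *)
Let K_lt : (p + 3) * K < B.
Proof.
rewrite /B /K mul2n -addnn expnD; have := expn_gt0 2 w.
move: lt_p; move: (2 ^ w) => x le_x x0; nia.
Qed.

Let topE : digits B top n.+2 = a * B ^ n.+1.
Proof.
rewrite digitsSr /top eqxx /digits big1 // => i _.
by rewrite ltn_eqF.
Qed.

Let le_rcK i : p * rev c i <= K.
Proof.
by rewrite /rev; case: (leqP i n) => _; rewrite ?muln0 ?le_cK ?leq_subr.
Qed.

Let le_digits f g : (forall i, i < n.+2 -> f i <= g i) -> digits B f n.+2 <= digits B g n.+2.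
Proof. by move=> le_fg; apply: leq_sum => i _; rewrite leq_mul2r le_fg ?orbT. Qed.

(** Free of subtraction, this can be compared digit by digit; [M] dominates [a * B ^ n.+1], so
    nothing is truncated. *)
Let slack1E z : tent_slack1 z + (p * z + a * B ^ n.+1) = M + B * z.
Proof.
have leA : a * B ^ n.+1 <= M.
  rewrite /M -digits_const -topE; apply: le_digits => i _; rewrite /top; case: ifP => //.
have leP : p <= B by move: K_lt lt_p; rewrite /K; nia.
have E : (B - p) * z + p * z = B * z by rewrite -mulnDl subnK.
by rewrite /tent_slack1 -E; lia.
Qed.

Let slack2E z : tent_slack2 z + (p * digits B (rev c) n.+2 + a * B ^ n.+1) = M + (p * z + B * z).
Proof.
rewrite /tent_slack2; set u := _ + a * _.
have leA : u <= M.
  rewrite /M -digits_const /u -topE digitsM digitsD; apply: le_digits => i lt_i.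
  rewrite /top; case: eqP => [->|_]; last by rewrite addn0.
  by rewrite /rev ltnn muln0.
by rewrite mulnDl; lia.
Qed.

Let le_K (f : nat -> nat) : (forall i, f i < 2 ^ w) -> forall i, f i <= K.
Proof. by move=> lt_f i; rewrite /K; have := lt_f i; lia. Qed.

(** Comparing digits turns the three masks into the linear constraints on the digits of [z]; where
    all higher digits agree with [t], they bound the next digit by the tent map. *)
Lemma tent_code_max z : odd 'C(M, z) -> odd 'C(M, tent_slack1 z) ->
  odd 'C(M, tent_slack2 z) -> z < B ^ n.+1 -> z <= tent_code.
Proof.
case/masked_digitsP => x zE /le_K-lex.
case/masked_digitsP => y1 y1E /le_K-ley1.
case/masked_digitsP => y2 y2E /le_K-ley2.
move=> lt_z.
have le_pK i : p * x i <= p * K by rewrite leq_mul2l lex orbT.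
have le_topK i : top i <= K by rewrite /top; case: ifP.
have xn0 : x n.+1 = 0.
  apply/eqP; rewrite -leqn0 leqNgt; apply/negP => x_gt0.
  move: lt_z; rewrite zE digitsSr; apply/negP; rewrite -leqNgt.
  by apply: leq_trans (leq_addl _ _); rewrite leq_pmull.
have le_shK i : shift_digits x i <= K by case: i => //=.
have E1 i : i < n.+2 -> y1 i + (p * x i + top i) = K + shift_digits x i.
  move=> lt_i; apply: (@digits_inj B (fun i => y1 i + (p * x i + top i))
    (fun i => K + shift_digits x i) n.+2) => // [j _|j _|].
  - apply: leq_ltn_trans K_lt; rewrite mulnDl.
    by have := ley1 j; have := le_pK j; have := le_topK j; lia.
  - by apply: leq_ltn_trans K_lt; rewrite mulnDl; have := le_shK j; lia.
  rewrite -!digitsD -digitsM digits_const -digits_shift // topE -zE -y1E.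
  exact: slack1E.
have E2 i : i < n.+2 -> y2 i + (p * rev c i + top i) = K + (p * x i + shift_digits x i).
  move=> lt_i; apply: (@digits_inj B (fun i => y2 i + (p * rev c i + top i))
    (fun i => K + (p * x i + shift_digits x i)) n.+2) => // [j _|j _|].
  - apply: leq_ltn_trans K_lt; rewrite mulnDl.
    by have := ley2 j; have := le_rcK j; have := le_topK j; lia.
  - by apply: leq_ltn_trans K_lt; rewrite mulnDl; have := le_shK j; have := le_pK j; lia.
  rewrite -!digitsD -!digitsM digits_const -digits_shift // topE -zE -y2E.
  exact: slack2E.
rewrite zE; apply: leq_digits_lex => [i _|k lt_k eq_k].
  by apply: leq_ltn_trans K_lt; rewrite mulnDl; have := lex i; lia.
have [->|lt_kn] : k = n.+1 \/ k.+1 < n.+2 by lia.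
  by rewrite xn0.
(* Multiplication by [B] shifts digits up, so digit [k] is constrained by the equations at position
   [k.+1]. *)
have := E1 _ lt_kn; have := E2 _ lt_kn; have := ley1 k.+1; have := ley2 k.+1.
have rev_k : rev t k = t (n - k) by rewrite /rev -ltnS -ltnS lt_kn.
rewrite /= rev_k; have [kn|lt_k_n] : k = n \/ k < n by lia.
  by rewrite kn xn0 /top eqxx subnn t0; lia.
rewrite eq_k ?ltnSn // /rev lt_k_n /top eqSS (ltn_eqF lt_k_n) !addn0.
have -> : n - k = (n - k.+1).+1 by lia.
rewrite tS; have := le_tc (n - k.+1); move: (t _) (c _) => u v le_uv.
rewrite -(subnK le_uv) addnK mulnDr minnMr leq_min; lia.
Qed.

Lemma tent_code_masked : [/\ odd 'C(M, tent_code), odd 'C(M, tent_slack1 tent_code),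
   odd 'C(M, tent_slack2 tent_code) & tent_code < B ^ n.+1].
Proof.
have le_ptK i : i <= n -> p * t i <= K.
  by move=> le_i; apply: leq_trans (le_cK le_i); rewrite leq_mul2l le_tc orbT.
have tS1 i : t i.+1 <= p * t i by rewrite tS leq_mul2l geq_minl orbT.
have tS2 i : p * t i + t i.+1 <= p * c i.
  by rewrite tS -mulnDr leq_mul2l; have := le_tc i; case: (leqP (t i) (c i - t i)); lia.
have le_tK i : i <= n -> t i <= K.
  case: i => [|i] lt_i; first by rewrite t0.
  by apply: leq_trans (tS1 i) (le_ptK _ _); apply: ltnW.
have lt_K x : x <= K -> x < 2 ^ w by rewrite /K; have := expn_gt0 2 w; lia.
have le_K_B x : x <= K -> x < B.
  by move=> lex; apply: leq_ltn_trans K_lt; rewrite mulnDl; lia.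
have revn1 : rev t n.+1 = 0 by rewrite /rev ltnn.
have le_prtK i : p * rev t i <= K.
  by rewrite /rev; case: (leqP i n) => // _; rewrite ?muln0 // le_ptK ?leq_subr.
have le_rtK i : rev t i <= K by rewrite /rev; case: (leqP i n) => // _; rewrite le_tK ?leq_subr.
(* The constraints by position: 0 needs only [t n <= c n], [n.+1] expresses [t 0 = a], the others
   are [tS1] and [tS2]. *)
have sh i : i < n.+2 -> shift_digits (rev t) i <= p * rev t i + top i /\
    p * rev t i + shift_digits (rev t) i <= p * rev c i + top i.
  case: i => [|i]; first by rewrite /rev leq0n subn0 !addn0 leq_mul2l le_tc orbT.
  rewrite !ltnS /= /rev /top eqSS => le_i; rewrite le_i.
  case: eqVneq => [->|ne_in]; first by rewrite ltnn subnn t0 !muln0.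
  have lt_in : i < n by lia.
  rewrite lt_in !addn0; have -> : n - i = (n - i.+1).+1 by lia.
  by split; [apply: tS1|apply: tS2].
split.
- by apply/masked_digitsP; exists (rev t) => // i; apply: lt_K.
(* The digits are [K] minus the slacks, cut to 0 beyond the number because the bound is required at
   every index. *)
- apply/masked_digitsP; exists (fun i => if i < n.+2 then
    K + shift_digits (rev t) i - (p * rev t i + top i) else 0); last first.
    by move=> i; apply: lt_K; case: ifP => // lt_i; have [] := sh i lt_i; lia.
  apply/eqP; rewrite -(eqn_add2r (p * tent_code + a * B ^ n.+1)) slack1E.
  rewrite /tent_code digits_shift // -topE digitsM /M -digits_const !digitsD.
  apply/eqP/eq_digits => i lt_i.
  rewrite lt_i subnK //; apply: leq_trans (leq_addr _ _).
  rewrite /top; case: eqP => [->|_]; last by rewrite addn0.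
  by rewrite revn1 muln0.
- apply/masked_digitsP; exists (fun i => if i < n.+2 then
    K + (p * rev t i + shift_digits (rev t) i) - (p * rev c i + top i) else 0); last first.
    by move=> i; apply: lt_K; case: ifP => // lt_i; have [] := sh i lt_i; lia.
  apply/eqP; rewrite -(eqn_add2r (p * digits B (rev c) n.+2 + a * B ^ n.+1)) slack2E.
  rewrite /tent_code digits_shift // -topE !digitsM /M -digits_const !digitsD.
  apply/eqP/eq_digits => i lt_i.
  rewrite lt_i subnK //; apply: leq_trans (leq_addr _ _).
  rewrite /top; case: eqP => [->|_]; last by rewrite addn0.
  by rewrite /rev ltnn muln0.
by rewrite /tent_code digitsSr revn1 addn0; apply: digits_lt => i _; apply: le_K_B.
Qed.

Lemma tent_code_mod : tent_code %% B = t n.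
Proof.
rewrite /tent_code digitsSl addnC mulnC modnMDl /rev subn0 modn_small //.
have le_K_B x : x <= K -> x < B.
  by move=> lex; apply: leq_ltn_trans K_lt; rewrite mulnDl; lia.
apply: le_K_B; case: (n) le_cK => [|i] le_c; first by rewrite t0.
by rewrite tS (leq_trans _ (le_c i _)) // leq_mul2l (leq_trans (geq_minl _ _)) ?orbT // le_tc.
Qed.
End TentMask.

(** * Three masks in one binomial coefficient *)

Section MaskedTent.
Variables (w n a p : nat) (c t : nat -> nat).
Let B := 2 ^ (2 * w).
Let M := (2 ^ w - 1) * repunit B n.+2.
Let D := B ^ n.+3.

Hypothesis lt_p : p + 3 <= 2 ^ w.
Hypothesis le_aK : a <= 2 ^ w - 1.
Hypothesis le_cK : forall i, i <= n -> p * c i <= 2 ^ w - 1.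
Hypothesis t0 : t 0 = a.
Hypothesis tS : forall i, t i.+1 = p * minn (t i) (c i - t i).
Hypothesis le_tc : forall i, t i <= c i.

Let B_gt1 : 1 < B.
Proof. by rewrite -(expn0 2) ltn_exp2l // muln_gt0 /=; case: (w) lt_p => //; lia. Qed.

Let M_lt : M < B ^ n.+2.
Proof.
have le_K : 2 ^ w - 1 <= B - 1 by rewrite leq_sub2r // leq_exp2l // leq_pmull.
apply: (@leq_ltn_trans ((B - 1) * repunit B n.+2)); first by rewrite leq_mul2r le_K orbT.
by rewrite repunit_expn subn1 ltn_predL expn_gt0 ltnW.
Qed.

Lemma odd_bin_tent_fields z : z < B ^ n.+1 ->
  odd 'C(M + D * (M + D * M), z + D * (tent_slack1 w n a p z + D * tent_slack2 w n a p c z)) =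
  [&& odd 'C(M, z), odd 'C(M, tent_slack1 w n a p z) & odd 'C(M, tent_slack2 w n a p c z)].
Proof.
move=> lt_z; have B0 := ltnW B_gt1.
have DE : D = 2 ^ (2 * w * n.+3) by rewrite expnM.
have lt_B2 x : x < B ^ n.+2 -> x < D by move=> H; apply: ltn_trans H _; rewrite ltn_exp2l.
have lt_M := lt_B2 _ M_lt.
have lt_zD : z < D by apply: lt_B2; apply: ltn_trans lt_z _; rewrite ltn_exp2l.
(* The slack is at most [M + B * z], below [2 * B ^ n.+2]; this is why fields have [n.+3] digits. *)
have lt_s : tent_slack1 w n a p z < D.
  apply: (@leq_ltn_trans (M + B * z)).
    by rewrite /tent_slack1 leq_add ?leq_subr // leq_mul2r leq_subr orbT.
  have : B * z <= B ^ n.+2 by rewrite (expnS _ n.+1) leq_mul2l ltnW ?orbT.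
  have : 2 * B ^ n.+2 <= D by rewrite [D]expnS leq_mul2r B_gt1 orbT.
  by move: M_lt; move: (B ^ n.+2) (B * z); lia.
by rewrite DE !odd_bin_digits -?DE.
Qed.

Lemma tent_code_greatest :
  let z0 := tent_code w n t in
  [/\ z0 < B ^ n.+1,
     odd 'C(M + D * (M + D * M), z0 + D * (tent_slack1 w n a p z0 + D * tent_slack2 w n a p c z0))
   & forall z, z0 < z < B ^ n.+1 ->
     ~~ odd 'C(M + D * (M + D * M), z + D * (tent_slack1 w n a p z + D * tent_slack2 w n a p c z))].
Proof.
have [o0 o1 o2 lt_z0] := tent_code_masked lt_p le_aK le_cK t0 tS le_tc.
split=> // [|z /andP[lt_z ltz]]; first by rewrite odd_bin_tent_fields // o0 o1 o2.
rewrite odd_bin_tent_fields //; apply/and3P => -[oz oz1 oz2].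
by move: lt_z; rewrite ltnNge (tent_code_max lt_p le_aK le_cK t0 tS le_tc).
Qed.
End MaskedTent.

(** * The term for the tent map *)

Section TentTerm.
Let va : aterm 5 := AVar (@Ordinal 5 0 isT).
Let vb : aterm 5 := AVar (@Ordinal 5 1 isT).
Let vp : aterm 5 := AVar (@Ordinal 5 2 isT).
Let vq : aterm 5 := AVar (@Ordinal 5 3 isT).
Let vn : aterm 5 := AVar (@Ordinal 5 4 isT).
(** A width [w] that bounds [p + 2], [a], [q] and every [p * b * q ^ i] with [i <= n]. *)
Let tw := ((vp + 2%:A) * (vb * vq ^ (vn + 1%:A)))%A.
Let tB := (2%:A ^ (2%:A * tw))%A.
Let tM := ((2%:A ^ tw - 1%:A) * arepunit tB (vn + 2%:A))%A.
Let tD := (tB ^ (vn + 3%:A))%A.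
Let tH := (tB ^ (vn + 1%:A))%A.
(** The geometric sum of the [b * q ^ i * B ^ (n - i)], i.e. the bounds [c] in reversed order as
    digits. *)
Let tC := (vb * ((tH - vq ^ (vn + 1%:A)) %/ (tB - vq)))%A.
(** [tal * z + tbe] concatenates [z] and its two slacks in base [D], affinely in [z]; [tm] is three
    copies of the mask. *)
Let tal := (1%:A + tD * ((tB - vp) + tD * (tB + vp)))%A.
Let tbe := (tD * ((tM - va * tH) + tD * (tM - (vp * tC + va * tH))))%A.
Let tm := (tM + tD * (tM + tD * tM))%A.
Definition atent : aterm 5 := (amax_masked tal tbe tm tH %% tB)%A.

Lemma aeval_tent (a b p q n : nat) (t : nat -> nat) :
  0 < b -> 0 < q -> a <= b ->
  t 0 = a -> (forall i, t i.+1 = p * minn (t i) (b * q ^ i - t i)) ->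
  (forall i, t i <= b * q ^ i) ->
  aeval [tuple a; b; p; q; n] atent = t n.
Proof.
move=> b0 q0 le_ab t0 tS le_tc; set v := [tuple a; b; p; q; n].
pose w := (p + 2) * (b * q ^ n.+1); pose c i := b * q ^ i.
have lt_w : w < 2 ^ w by apply: ltn_expl.
have bq0 : 0 < b * q ^ n.+1 by rewrite muln_gt0 b0 expn_gt0 q0.
have le_pw : p + 2 <= w by rewrite leq_pmulr.
have le_cw i : i <= n.+1 -> b * q ^ i <= b * q ^ n.+1.
  by move=> le_i; rewrite leq_mul2l leq_pexp2l ?orbT.
have le_bw : b * q ^ n.+1 <= w by rewrite leq_pmull // addn2.
have lt_p : p + 3 <= 2 ^ w by lia.
have le_aK : a <= 2 ^ w - 1.
  by have := le_cw 0 isT; rewrite muln1; lia.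
have le_cK i : i <= n -> p * c i <= 2 ^ w - 1.
  move=> le_i; have : p * c i <= w by rewrite leq_mul ?le_cw ?leqW // leq_addr.
  by lia.
(* Leads to [q < B], which makes the quotient in [tC] exact. *)
have le_qw : q <= w.
  apply: leq_trans le_bw; apply: leq_trans (leq_pmull _ b0).
  by rewrite -{1}(expn1 q) leq_pexp2l.
pose B := 2 ^ (2 * w).
have lt_qB : q < B.
  apply: leq_ltn_trans le_qw (leq_trans lt_w _).
  by rewrite leq_exp2l // leq_pmull.
have B_gt1 : 1 < B by apply: leq_ltn_trans lt_qB.
have Ev_B : aeval v tB = B by rewrite /B /w -(addn1 n).
have Ev_H : aeval v tH = B ^ n.+1 by rewrite -(addn1 n) -Ev_B.
have Ev_D : aeval v tD = B ^ n.+3 by rewrite -(addn3 n) -Ev_B.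
have Ev_M : aeval v tM = (2 ^ w - 1) * repunit B n.+2.
  rewrite -[LHS]/((2 ^ aeval v tw - 1) * aeval v (arepunit tB (vn + 2%:A)%A)).
  by rewrite aeval_repunit Ev_B // -[aeval v (vn + _)%A]/(n + 2) addn2 /w -(addn1 n).
have Ev_C : aeval v tC = digits B (fun i => if i <= n then c (n - i) else 0) n.+2.
  rewrite digitsSr ltnn addn0 -[LHS]/(b * ((aeval v tH - q ^ (n + 1)) %/ (aeval v tB - q))).
  rewrite Ev_H Ev_B addn1 subn_exp mulKn ?subn_gt0 //.
  rewrite -(big_mkord xpredT (fun i => B ^ (n.+1.-1 - i) * q ^ i)) big_nat_rev /= big_mkord add0n.
  rewrite big_distrr /=; apply: eq_bigr => i _; have lt_i := ltn_ord i.
  by rewrite -ltnS lt_i subSS subKn // /c mulnC; ring.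
have al_be z : aeval v tal * z + aeval v tbe =
    z + B ^ n.+3 * (tent_slack1 w n a p z + B ^ n.+3 * tent_slack2 w n a p c z).
  rewrite -[aeval v tal]/(1 + aeval v tD * ((aeval v tB - p) + aeval v tD * (aeval v tB + p))).
  rewrite -[aeval v tbe]/(aeval v tD * ((aeval v tM - a * aeval v tH) + aeval v tD *
    (aeval v tM - (p * aeval v tC + a * aeval v tH)))).
  rewrite Ev_D Ev_B Ev_M Ev_H Ev_C /tent_slack1 /tent_slack2 -/B; ring.
have Ev_m : aeval v tm = (2 ^ w - 1) * repunit B n.+2 + B ^ n.+3 *
    ((2 ^ w - 1) * repunit B n.+2 + B ^ n.+3 * ((2 ^ w - 1) * repunit B n.+2)).
  by rewrite -Ev_M -Ev_D.
have [lt_z0 odd_z0 even_z] := tent_code_greatest lt_p le_aK le_cK t0 tS le_tc.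
rewrite -[LHS]/(aeval v (amax_masked tal tbe tm tH) %% aeval v tB).
rewrite (@aeval_max_masked _ _ _ _ _ _ (tent_code w n t)) ?Ev_H ?Ev_m ?al_be //.
  by rewrite Ev_B (tent_code_mod lt_p le_aK le_cK t0 tS le_tc).
by move=> z; rewrite al_be; apply: even_z.
Qed.
End TentTerm.

Lemma tent_step_quotient (R : realFieldType) (a b p q : nat) :
  0 < b -> a <= b ->
  (p%:R / q%:R * Num.min (a%:R / b%:R) (1 - a%:R / b%:R) =
     (p * minn a (b - a))%:R / (q * b)%:R :> R)%R.
Proof.
move=> b0 le_ab; have b0R : (0 < (b%:R : R))%R by rewrite ltr0n.
have -> : (1 - a%:R / b%:R = (b - a)%:R / b%:R :> R)%R.
  by rewrite natrB // mulrBl divff // gt_eqF.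
have -> : (Num.min (a%:R / b%:R) ((b - a)%:R / b%:R) = (minn a (b - a))%:R / b%:R :> R)%R.
  case: (leqP a (b - a)) => [le|/ltnW le].
    by apply: min_l; rewrite ler_pM2r ?invr_gt0 // ler_nat.
  by apply: min_r; rewrite ler_pM2r ?invr_gt0 // ler_nat.
by rewrite !natrM mulf_div.
Qed.

Theorem mainTheorem7 :
  exists M : aterm 5,
  forall (a b p q : nat), 1 <= b -> 1 <= q -> a <= b -> p <= 2 * q ->
  forall (x : nat -> rat),
    x 0 = (a%:R / b%:R)%R ->
    (forall n, x n.+1 = ((p%:R / q%:R) * Num.min (x n) (1 - x n))%R) ->
  forall (an bn : nat -> nat),
    an 0 = a -> bn 0 = b ->
    (forall n, an n.+1 = p * minn (an n) (bn n - an n)) ->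
    (forall n, bn n.+1 = q * bn n) ->
  forall n : nat,
    [/\ bn n = b * q ^ n,
        an n = aeval [tuple a; b; p; q; n] M %/ (b * q ^ n + 1) ^ n
      & x n = ((an n)%:R / (bn n)%:R)%R].
Proof.
(* Multiplying [atent] by the prescribed divisor makes the floor division exact. *)
exists (atent * (AVar (@Ordinal 5 1 isT) * AVar (@Ordinal 5 3 isT) ^ AVar (@Ordinal 5 4 isT)
  + 1%:A) ^ AVar (@Ordinal 5 4 isT))%A => a b p q b0 q0 le_ab le_p x x0 xS an bn an0 bn0 anS bnS n.
have bnE i : bn i = b * q ^ i.
  by elim: i => [|i IHi]; rewrite ?muln1 // bnS IHi expnS mulnCA.
(* Since [2 * minn u (v - u) <= v] and [p <= 2 * q], the bound is preserved, so [bn i - an i] is a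
   true difference. *)
have le_an i : an i <= bn i.
  elim: i => [|i IHi]; first by rewrite an0 bn0.
  rewrite anS bnS; apply: (@leq_trans (2 * q * minn (an i) (bn i - an i))).
    by rewrite leq_mul2r le_p orbT.
  rewrite mulnAC mulnC leq_mul2l; apply/orP; right.
  by case: leqP; lia.
split=> //.
  rewrite -[aeval _ _]/(aeval [tuple a; b; p; q; n] atent * (b * q ^ n + 1) ^ n).
  rewrite mulnK ?expn_gt0 ?addn1 // (@aeval_tent _ _ _ _ _ an) // => [i|i]; rewrite -bnE //.
elim: n => [|i IHi]; first by rewrite x0 an0 bn0.
rewrite xS IHi anS bnS -tent_step_quotient //.
by rewrite bnE muln_gt0 b0 expn_gt0 q0.
Qed.
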